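(* Let $T_{\mathfrak{sl}_4} \in \mathfrak{sl}_4^* \otimes \mathfrak{sl}_4^* \otimes \mathfrak{sl}_4$ be the structure tensor of the complex Lie algebra $\mathfrak{sl}_4$. Then its border rank satisfies $\underline{\mathbf{R}}(T_{\mathfrak{sl}_4}) \geq 28$.
   Context: $\mathfrak{sl}_n$ denotes the Lie algebra of traceless $n\times n$ complex matrices with bracket $[x,y]=xy-yx$. Its structure tensor $T_{\mathfrak{sl}_n}\in \mathfrak{sl}_n^*\otimes\mathfrak{sl}_n^*\otimes\mathfrak{sl}_n$ is the tensor corresponding to the bilinear map $(x,y)\mapsto [x,y]$; in a basis $\{a_i\}$ with dual basis $\{\alpha^i\}$ and $[a_i,a_j]=\sum_k A_{ij}^k a_k$, it is $\sum_{i,j,k} A_{ij}^k\,\alpha^i\otimes\alpha^j\otimes a_k$. For a tensor $T\in A\otimes B\otimes C$ over $\mathbb{C}$, the rank of $T$ is the minimal $r$ with $T=\sum_{i=1}^r a_i\otimes b_i\otimes c_i$, and the border rank $\underline{\mathbf{R}}(T)$ is the minimal $r$ such that $T=\lim_{\epsilon\to 0}T_\epsilon$ with each $T_\epsilon$ of rank at most $r$. *)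

(* Defs.v *)
From HB Require Import structures.
From mathcomp Require Import all_boot all_order all_algebra.
From mathcomp Require Import complex.
From mathcomp Require Import Rstruct.
Set Implicit Arguments. Unset Strict Implicit. Unset Printing Implicit Defensive.
Import Order.TTheory GRing.Theory Num.Theory.
Local Open Scope ring_scope.

Definition CC : Type := (Rdefinitions.R)[i].

Definition sl (n : nat) : pred 'M[CC]_n := fun x => \tr x == 0.

Definition lie_bracket (n : nat) (x y : 'M[CC]_n) : 'M[CC]_n := x *m y - y *m x.

(* f is a linear functional on sl_n (an element of sl_n^dual); its values
   outside sl_n are irrelevant. *)
Definition lin_functional_on (n : nat) (f : 'M[CC]_n -> CC) : Prop :=
  forall (a : CC) (x y : 'M[CC]_n), x \in @sl n -> y \in @sl n ->
    f (a *: x + y) = a * f x + f y.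

(* An element of sl_n^dual (x) sl_n^dual (x) sl_n is represented by the bilinear map
   sl_n x sl_n -> sl_n it defines (values off sl_n are irrelevant).
   tensor_rank_le n B r : B = sum_{i<r} alpha_i (x) beta_i (x) c_i, i.e.
   B(x,y) = sum_i alpha_i(x) beta_i(y) c_i on sl_n, with alpha_i, beta_i in
   sl_n^dual and c_i in sl_n. *)
Definition tensor_rank_le (n : nat) (B : 'M[CC]_n -> 'M[CC]_n -> 'M[CC]_n)
    (r : nat) : Prop :=
  exists (alpha beta : 'I_r -> 'M[CC]_n -> CC) (c : 'I_r -> 'M[CC]_n),
    (forall i, lin_functional_on (alpha i)) /\
    (forall i, lin_functional_on (beta i)) /\
    (forall i, c i \in @sl n) /\
    (forall x y, x \in @sl n -> y \in @sl n ->
       B x y = \sum_(i < r) (alpha i x * beta i y) *: c i).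

Definition cvg_seqC (u : nat -> CC) (l : CC) : Prop :=
  forall e : CC, 0 < e -> exists N : nat, forall k : nat, (N <= k)%N ->
    `|u k - l| < e.

(* Convergence of a sequence of tensors (bilinear maps on the finite-dimensional
   space sl_n): pointwise on sl_n x sl_n and entrywise, which is equivalent
   to convergence in the Euclidean topology of sl_n^dual (x) sl_n^dual (x) sl_n. *)
Definition cvg_tensor (n : nat) (Bs : nat -> 'M[CC]_n -> 'M[CC]_n -> 'M[CC]_n)
    (B : 'M[CC]_n -> 'M[CC]_n -> 'M[CC]_n) : Prop :=
  forall x y, x \in @sl n -> y \in @sl n ->
    forall i j, cvg_seqC (fun k => Bs k x y i j) (B x y i j).

Definition border_rank_le (n : nat) (B : 'M[CC]_n -> 'M[CC]_n -> 'M[CC]_n)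
    (r : nat) : Prop :=
  exists Bs : nat -> 'M[CC]_n -> 'M[CC]_n -> 'M[CC]_n,
    (forall k, tensor_rank_le (Bs k) r) /\ cvg_tensor Bs B.

(* Main.v *)
(* If the border rank were at most 27, write the bracket as a limit of tensors B_k of
   rank at most 27.  Restricting the first factor to the kernel of one of the functionals
   of the decomposition, normalised as a matrix A_k, leaves rank at most 26; by compactness
   A_k converges to some A <> 0.  The bracket is invariant under conjugation, so A may be
   replaced by any matrix in the closure of its conjugates up to scaling: first make the
   entry A_30 nonzero, then degenerate along a torus to a multiple of E_30.  Hence for nine
   vectors v_0, ..., v_8 without (0,3) entry the Koszul flattening
     L^4 C^9 (x) sl_4 -> L^5 C^9 (x) sl_4,   e_S (x) y |-> sum_i e_i ^ e_S (x) [v_i, y]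
   is a limit of flattenings of tensors of rank 26.  A rank one tensor has flattening of
   rank at most C(8,4) = 70, and rank is lower semicontinuous, so this one has rank at most
   26 * 70 = 1820.  For the chosen v_i, exact sparse elimination over Z exhibits 1828
   independent vectors in its row space.

   A basis vector e_S is encoded as the bit mask of S, and the coordinate e_S (x) E_ab as a
   positive number, so that elimination can be run on sparse lists sorted by key. *)

From Stdlib Require Import ZArith FMapPositive Rtopology.
Require Import Defs.
From HB Require Import structures.
From mathcomp Require Import all_boot all_order all_algebra all_fingroup.
From mathcomp Require Import complex.
From mathcomp Require Import boolp Rstruct.
From mathcomp Require Import ring.
Set Implicit Arguments. Unset Strict Implicit. Unset Printing Implicit Defensive.
Import Order.TTheory GRing.Theory Num.Theory.
Local Open Scope ring_scope.

(** * Koszul maps *)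

Section Koszul.
Variables (F : numFieldType) (V : lmodType F).

Definition ins (i : nat) (S : bitseq) : bitseq := set_nth false S i true.
(** The sign that brings e_i ^ e_S into increasing order: one factor -1 for each element of S below
    i. *)
Definition msgn (i : nat) (S : bitseq) : F := (-1) ^+ count id (take i S).

Lemma insC i j S : ins i (ins j S) = ins j (ins i S).
Proof.
rewrite /ins; apply: (@eq_from_nth _ false) => [|k _].
  by rewrite !size_set_nth maxnCA.
by rewrite !nth_set_nth /= !nth_set_nth /=; do 2!case: (k == _).
Qed.

Lemma nth_ins i j S : nth false (ins i S) j = (j == i) || nth false S j.
Proof. by rewrite /ins nth_set_nth /=; case: (j == i). Qed.

Lemma size_ins i S : (i < size S)%N -> size (ins i S) = size S.
Proof. by move=> h; rewrite /ins size_set_nth; apply/maxn_idPr. Qed.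

Lemma take_ins_ge i j S : (j <= i)%N -> (i < size S)%N -> take j (ins i S) = take j S.
Proof.
move=> ji iS; have jS := leq_ltn_trans ji iS.
apply: (@eq_from_nth _ false) => [|k]; rewrite !size_take ?size_ins //.
rewrite jS => kj; rewrite !nth_take // nth_ins.
by rewrite ltn_eqF // (leq_trans kj ji).
Qed.

Lemma count_set_nth_false i S : (i < size S)%N -> ~~ nth false S i ->
  count id (ins i S) = (count id S).+1.
Proof.
rewrite /ins; elim: S i => [|b S IH] [|i] //=; first by case: b.
by move=> iS Hi; rewrite IH // addnS.
Qed.

Lemma take_ins_lt i j S : (i < j)%N -> (j <= size S)%N ->
  take j (ins i S) = ins i (take j S).
Proof.
rewrite /ins; elim: S i j => [|b S IH] [|i] [|j] //= ij jS; congr cons.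
exact: IH.
Qed.

(** The sign rule e_i ^ e_j = - e_j ^ e_i. For i < j, inserting i raises by one the count in front
    of j, while inserting j leaves the count in front of i unchanged. *)
Lemma msgn_insC i j S : (i < size S)%N -> (j < size S)%N -> i != j ->
  ~~ nth false S i -> ~~ nth false S j ->
  msgn j S * msgn i (ins j S) = - (msgn i S * msgn j (ins i S)).
Proof.
wlog ij : i j / (i < j)%N.
  move=> H iS jS nij hi hj; case: (ltngtP i j) nij => // ij _.
    by apply: H; rewrite ?ltn_eqF.
  by rewrite (H j i) ?opprK // eq_sym gtn_eqF.
move=> iS jS _ hi hj; rewrite /msgn (take_ins_ge (ltnW ij)) // take_ins_lt // ?(ltnW jS) //.
rewrite count_set_nth_false ?nth_take // ?size_take ?jS //.
by rewrite exprS; ring.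
Qed.

Variables (n : nat) (al : 'I_n -> F) (U : bitseq -> V).

(** The image of e_S under wedging with the sum of the al_i e_i, where [U T] stands for e_T (x) c
    with a fixed c. *)
Definition krow (S : bitseq) : V :=
  \sum_(i < n) if nth false S i then 0 else (al i * msgn i S) *: U (ins i S).

(** Wedging twice with the same vector gives zero: exchanging the two inserted indices negates each
    summand, so the double sum is its own negative. *)
Lemma krow_sq0 (S : bitseq) : size S = n ->
  \sum_(j < n) (if nth false S j then 0 else (al j * msgn j S) *: krow (ins j S)) = 0.
Proof.
move=> sS.
pose G (i j : 'I_n) : V := if nth false S j || nth false S i || (i == j) then 0 else
  (al j * al i * (msgn j S * msgn i (ins j S))) *: U (ins i (ins j S)).
have GN i j : G i j = - G j i.
  rewrite /G (eq_sym j) [nth _ _ j || _]orbC.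
  case: ifP; rewrite ?oppr0 // => /negbT; rewrite !negb_or => /andP[/andP[hi hj] ij].
  rewrite msgn_insC ?sS // insC -scaleNr; congr (_ *: _); ring.
have -> : \sum_(j < n) (if nth false S j then 0 else (al j * msgn j S) *: krow (ins j S))
   = \sum_j \sum_i G i j.
  apply: eq_bigr => j _; rewrite /G; case: ifP => hj /=; first by rewrite big1.
  rewrite /krow scaler_sumr; apply: eq_bigr => i _; rewrite nth_ins.
  rewrite orbC; case: ifP => _; rewrite ?scaler0 // scalerA; congr (_ *: _); ring.
set s := (LHS in LHS = _); have : s = - s.
  rewrite {1}/s exchange_big /= -sumrN; apply: eq_bigr => j _.
  by rewrite -sumrN; apply: eq_bigr => i _; apply: GN.
move/eqP; rewrite -addr_eq0 -mulr2n -scaler_nat scaler_eq0 pnatr_eq0 /=.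
by move/eqP.
Qed.

Definition rem_mask (i : nat) (S : bitseq) : bitseq := set_nth false S i false.

Lemma ins_rem_mask i S : nth false S i -> ins i (rem_mask i S) = S.
Proof.
move=> h; have iS : (i < size S)%N by rewrite ltnNge; apply/negP => /(nth_default false); rewrite h.
apply: (@eq_from_nth _ false) => [|k _].
  by rewrite /ins /rem_mask !size_set_nth; do 2!rewrite (maxn_idPr _) //.
by rewrite nth_ins /rem_mask nth_set_nth /=; case: eqP => [->|].
Qed.

(** Apply [krow_sq0] to S without i0 and solve for the summand at i0, whose coefficient is nonzero
    because [al i0] is. *)
Lemma krow_elim (i0 : 'I_n) (S : bitseq) : size S = n -> al i0 != 0 -> nth false S i0 ->
  exists f : 'I_n -> F, krow S = \sum_(j < n)
    if (j == i0) || nth false S j then 0 else f j *: krow (ins j (rem_mask i0 S)).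
Proof.
move=> sS a0 hS; set S' := rem_mask i0 S.
have sS' : size S' = n by rewrite /S' /rem_mask size_set_nth sS (maxn_idPr _).
have := krow_sq0 sS'; rewrite (bigD1 i0) //= {1}/S' /rem_mask nth_set_nth /= eqxx.
rewrite ins_rem_mask // => /eqP; rewrite addr_eq0 => /eqP E.
have c0 : al i0 * msgn i0 S' != 0 by rewrite mulf_neq0 // expf_neq0 // oppr_eq0 oner_eq0.
exists (fun j => - (al i0 * msgn i0 S')^-1 * (al j * msgn j S')).
rewrite -[LHS]scale1r -(mulVf c0) -scalerA E scalerN scaler_sumr -sumrN [RHS](bigD1 i0) //= eqxx add0r.
apply: eq_bigr => j ji0; have nji : (j == i0 :> nat) = false by apply: negPf.
rewrite (negPf ji0) /= {1}/S' /rem_mask nth_set_nth /= nji.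
by case: ifP; rewrite ?scaler0 ?oppr0 // scalerA -scaleNr mulNr.
Qed.

End Koszul.

Fixpoint bmasks (n : nat) : seq bitseq :=
  if n is m.+1 then [seq b :: s | b <- [:: false; true], s <- bmasks m] else [:: [::]].

Lemma mem_bmasks n S : (S \in bmasks n) = (size S == n).
Proof.
elim: n S => [|n IH] [|b S] //.
  by apply/allpairsP => -[[? ?] []].
rewrite eqSS -IH; apply/allpairsP/idP => [[[b' s'] [/= _ h [_ ->]]] //|h].
by exists (b, S); split => //; case: b.
Qed.

Definition masks4 : seq bitseq := [seq s <- bmasks 9 | count id s == 4%N].
Definition masks4_avoid (i : nat) : seq bitseq := [seq s <- masks4 | ~~ nth false s i].

Lemma size_masks4_avoid (i : 'I_9) : size (masks4_avoid i) = 70%N.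
Proof.
have : (i < 9)%N by []; move: (i : nat) => m.
by do 9?[case: m => [|m]; first by vm_compute].
Qed.

Section KoszulRank.
Variables (F : numFieldType) (N : nat) (al : 'I_9 -> F) (U : bitseq -> 'rV[F]_N).

(* Rows through a mask containing i0 are combinations of those avoiding i0, so C(8,4) = 70 rows span. *)
Lemma krow_span70 : exists W : 'M[F]_(70, N),
  forall S, S \in masks4 -> (krow al U S <= W)%MS.
Proof.
case: (pickP (fun i => al i != 0)) => [i0 a0|a0]; last first.
  exists 0 => S _; rewrite [krow _ _ _](_ : _ = 0) ?sub0mx // /krow big1 // => i _.
  by have /negbFE/eqP -> := a0 i; rewrite mul0r scale0r if_same.
pose W : 'M[F]_(70, N) := \matrix_(i < 70) krow al U (nth [::] (masks4_avoid i0) i).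
have WS S : S \in masks4_avoid i0 -> (krow al U S <= W)%MS.
  move=> hS; have hi : (index S (masks4_avoid i0) < 70)%N.
    by rewrite -(size_masks4_avoid i0) index_mem.
  have -> : krow al U S = row (Ordinal hi) W by rewrite rowK /= nth_index.
  exact: row_sub.
exists W => S; have [hS|hS] := boolP (nth false S i0); last first.
  by move=> S4; apply: WS; rewrite mem_filter hS.
rewrite mem_filter mem_bmasks => /andP[/eqP S4 /eqP sS].
have [f ->] := krow_elim U sS a0 hS.
apply: summx_sub => j _; case: ifP => [_|/negbT]; rewrite ?sub0mx //.
rewrite negb_or => /andP[ji0 hj]; apply: scalemx_sub; apply: WS.
have sR : size (rem_mask i0 S) = 9%N by rewrite /rem_mask size_set_nth sS (maxn_idPr _).
have cR : count id (rem_mask i0 S) = 3%N.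
  have := S4; rewrite -{1}(ins_rem_mask hS) count_set_nth_false ?sR //; first by case.
  by rewrite /rem_mask nth_set_nth /= eqxx.
rewrite !mem_filter mem_bmasks size_ins ?sR // eqxx andbT.
rewrite count_set_nth_false ?sR // ?cR ?eqxx ?andbT /rem_mask.
  by rewrite nth_ins nth_set_nth /= eqxx orbF eq_sym.
by have nji : (j == i0 :> nat) = false by [apply: negPf]; rewrite nth_set_nth /= nji.
Qed.

End KoszulRank.

(** * Sparse elimination over the integers *)

Definition zC (z : Z) : CC := (Rdefinitions.IZR z)%:C%C.

Lemma zCD a b : zC (Z.add a b) = zC a + zC b.
Proof. by rewrite /zC RIneq.plus_IZR RplusE rmorphD. Qed.
Lemma zCM a b : zC (Z.mul a b) = zC a * zC b.
Proof. by rewrite /zC RIneq.mult_IZR RmultE rmorphM. Qed.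
Lemma zC0 : zC Z0 = 0. Proof. by []. Qed.
Lemma zC1 : zC (Zpos xH) = 1. Proof. by []. Qed.
Lemma zCN a : zC (Z.opp a) = - zC a.
Proof. by rewrite /zC RIneq.opp_IZR RoppE rmorphN. Qed.
Lemma zC_eq0 a : zC a = 0 -> a = Z0.
Proof. by case=> /RIneq.eq_IZR. Qed.

HB.instance Definition _ := hasDecEq.Build positive Pos.eqb_spec.
HB.instance Definition _ := hasDecEq.Build Z Z.eqb_spec.

(** Sparse rows are meant to have decreasing keys, so that the head is the pivot. The semantics
    [vec] sums all listed entries in any order, and [lead_ok] tests the resulting pivots
    directly. *)
Definition svec := seq (positive * Z).

Definition sscale (a : Z) (l : svec) : svec := [seq (kc.1, Z.mul a kc.2) | kc <- l].

Fixpoint comb (a b : Z) (l1 : svec) : svec -> svec :=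
  fix aux (l2 : svec) : svec :=
    match l1, l2 with
    | [::], _ => sscale b l2
    | _, [::] => sscale a l1
    | (k1, c1) :: t1, (k2, c2) :: t2 =>
      match Pos.compare k1 k2 with
      | Gt => (k1, Z.mul a c1) :: comb a b t1 l2
      | Lt => (k2, Z.mul b c2) :: aux t2
      | Eq => let c := Z.add (Z.mul a c1) (Z.mul b c2) in
              if Z.eqb c Z0 then comb a b t1 t2 else (k1, c) :: comb a b t1 t2
      end
    end.

(** With g = gcd(c, d), the combination (d/g) v - (c/g) p cancels the leading coefficients without
    leaving Z. Running out of fuel is safe: the vector stays in the span, and a repeated leading key
    would fail the strict order test in [pivots_ok]. *)
Fixpoint reduce (fuel : nat) (m : PositiveMap.t svec) (v : svec) : svec :=
  if fuel is f.+1 then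
    match v with
    | [::] => [::]
    | (k, c) :: _ =>
      match PositiveMap.find k m with
      | Some (((_, d) :: _) as p) =>
        let g := Z.gcd c d in reduce f m (comb (Z.div d g) (Z.opp (Z.div c g)) v p)
      | _ => v
      end
    end
  else v.

Fixpoint eliminate (m : PositiveMap.t svec) (acc rows : seq svec) : seq svec :=
  match rows with
  | [::] => acc
  | v :: rows' =>
    match reduce 400 m v with
    | [::] => eliminate m acc rows'
    | ((k, _) :: _) as w => eliminate (PositiveMap.add k w m) (w :: acc) rows'
    end
  end.

Definition shead (v : svec) : positive := if v is (k, _) :: _ then k else xH.

Definition lead_ok (v : svec) : bool :=
  if v is (k, c) :: t then ~~ Z.eqb c Z0 && all (fun kc => Pos.ltb kc.1 k) t else false.

Section Vec.
Variables (N : nat) (key : 'I_N -> positive).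

(** Keys outside the image of [key] are sent to zero. Later [key] lists the pivot keys only, so the
    flattening is projected to the pivot columns, which cannot raise its rank. *)
Definition ekey (k : positive) : 'rV[CC]_N := \row_j (Pos.eqb (key j) k)%:R.

Definition vec (l : svec) : 'rV[CC]_N := \sum_(kc <- l) zC kc.2 *: ekey kc.1.

Lemma vec_nil : vec [::] = 0. Proof. exact: big_nil. Qed.
Lemma vec_cons k c l : vec ((k, c) :: l) = zC c *: ekey k + vec l.
Proof. exact: big_cons. Qed.

Lemma vec_scale a l : vec (sscale a l) = zC a *: vec l.
Proof.
rewrite /vec big_map scaler_sumr; apply: eq_bigr => kc _.
by rewrite /= zCM scalerA.
Qed.

Lemma vec_comb a b l1 l2 : vec (comb a b l1 l2) = zC a *: vec l1 + zC b *: vec l2.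
Proof.
elim: l1 l2 => [|[k1 c1] t1 IH1].
  move=> l2; have -> : comb a b [::] l2 = sscale b l2 by case: l2.
  by rewrite vec_scale vec_nil scaler0 add0r.
elim=> [|[k2 c2] t2 IH2]; first by rewrite vec_nil scaler0 addr0 -vec_scale.
rewrite /=; case: Pos.compare_spec => [<-|_|_].
- have E : zC (Z.add (Z.mul a c1) (Z.mul b c2)) *: ekey k1 + vec (comb a b t1 t2) =
     zC a *: vec ((k1, c1) :: t1) + zC b *: vec ((k1, c2) :: t2).
    by rewrite IH1 !vec_cons zCD !zCM !scalerDr !scalerA scalerDl addrACA.
  by rewrite -E; case: Z.eqb_spec => [->|_]; rewrite ?vec_cons ?zC0 ?scale0r ?add0r.
- by rewrite vec_cons IH2 !vec_cons zCM !scalerDr !scalerA addrCA !addrA.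
- by rewrite vec_cons IH1 !vec_cons zCM !scalerDr !scalerA !addrA.
Qed.

Arguments comb : simpl never.
Variables (m : nat) (F : 'M[CC]_(m, N)).

Definition in_span (l : svec) : Prop := (vec l <= F)%MS.

Lemma in_span_reduce fuel mp v : in_span v ->
  (forall k p, PositiveMap.find k mp = Some p -> in_span p) -> in_span (reduce fuel mp v).
Proof.
move=> hv hm; elim: fuel v hv => [|f IH] [|[k c] t] hv //=.
case E: (PositiveMap.find k mp) => [[|[k' d] p]|] //.
apply: IH; rewrite /in_span vec_comb; apply: addmx_sub; apply: scalemx_sub; first exact: hv.
exact: hm E.
Qed.

Arguments reduce : simpl never.

Lemma in_span_eliminate mp acc rows :
  (forall k p, PositiveMap.find k mp = Some p -> in_span p) ->
  (forall v, v \in acc -> in_span v) -> (forall v, v \in rows -> in_span v) ->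
  forall v, v \in eliminate mp acc rows -> in_span v.
Proof.
elim: rows mp acc => [|r rows IH] mp acc hm ha hr //=.
have := in_span_reduce 400 (hr r (mem_head _ _)) hm.
have hr' v : v \in rows -> in_span v by move=> h; apply: hr; rewrite inE h orbT.
case: reduce => [|[k c] t] hw; first exact: IH.
apply: IH => // [k' p|v]; last by rewrite inE => /orP[/eqP ->|/ha].
rewrite PositiveMapAdditionalFacts.gsspec; case: PositiveMap.E.eq_dec => _; last exact: hm.
by case=> <-.
Qed.

End Vec.

(** * Rank bounds from triangular families *)

Section Triangular.
Variables (ps : seq svec).
Hypothesis lead_ps : all lead_ok ps.
Hypothesis sorted_ps : sorted (fun p q => Pos.ltb (shead p) (shead q)) ps.

Definition pkey (j : 'I_(size ps)) : positive := shead (nth [::] ps j).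

Lemma pkey_lt (i j : 'I_(size ps)) : (i < j)%N -> Pos.lt (pkey i) (pkey j).
Proof.
move=> ij; apply/Pos.ltb_lt.
have tr : transitive (fun p q => Pos.ltb (shead p) (shead q)).
  by move=> q p r /Pos.ltb_lt h1 /Pos.ltb_lt h2; apply/Pos.ltb_lt; apply: Pos.lt_trans h1 h2.
by apply: (sorted_ltn_nth tr [::] sorted_ps) => //; rewrite inE ltn_ord.
Qed.

Lemma vec_gt (l : svec) (j : 'I_(size ps)) :
  all (fun kc => Pos.ltb kc.1 (pkey j)) l -> vec pkey l 0 j = 0.
Proof.
rewrite /vec summxE => /allP h; rewrite big_seq big1 // => kc /h /Pos.ltb_lt lt.
rewrite !mxE; case: Pos.eqb_spec => [e|_]; last by rewrite mulr0.
by case: (Pos.lt_irrefl kc.1); rewrite -{2}e.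
Qed.

(** Restricted to their own leading keys, the pivots form a lower triangular matrix: the keys of row
    i are at most its leading key, which is below that of any later row. The diagonal holds the
    nonzero leading coefficients. *)
Lemma rank_triangular m (F : 'M[CC]_(m, size ps)) :
  (forall v, v \in ps -> in_span pkey F v) -> (size ps <= \rank F)%N.
Proof.
move=> hF; pose P : 'M[CC]_(size ps) := \matrix_(i < size ps) vec pkey (nth [::] ps i).
have trigP : is_trig_mx P.
  apply/is_trig_mxP => i j ij; rewrite mxE; apply: vec_gt.
  have := all_nthP [::] lead_ps i (ltn_ord i).
  have := pkey_lt ij; rewrite /pkey.
  case: (nth [::] ps i) => [|[k c] t] //= klt /andP[_ /allP ht].
  apply/andP; split; first exact/Pos.ltb_lt.
  apply/allP => kc /ht /Pos.ltb_lt h; apply/Pos.ltb_lt; exact: Pos.lt_trans h klt.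
have diagP i : P i i != 0.
  rewrite mxE; have := all_nthP [::] lead_ps i (ltn_ord i).
  have : pkey i = shead (nth [::] ps i) by [].
  case: (nth [::] ps i) => [|[k c] t] //= e /andP[c0 ht].
  rewrite vec_cons mxE vec_gt ?e // addr0 !mxE e Pos.eqb_refl mulr1.
  by apply: contra c0 => /eqP /zC_eq0 ->.
have uP : P \in unitmx.
  rewrite unitmxE det_trig // unitfE; apply/prodf_neq0 => i _; exact: diagP.
rewrite -[X in (X <= _)%N](mxrank_unit uP); apply: mxrankS.
apply/row_subP => i; rewrite rowK; apply: hF; exact: mem_nth.
Qed.

End Triangular.

(** * The Koszul flattening of the bracket *)

(** For S of length nine, the low nine bits are S, and above them 4a+b ones precede the leading bit,
    coding the position (a,b) in unary. *)
Definition keyof (S : bitseq) (a b : nat) : positive :=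
  foldr (fun (x : bool) p => if x then xI p else xO p) xH (S ++ nseq (4 * a + b)%N true).

Definition Emx (p q : nat) : 'M[CC]_4 := delta_mx (inord p) (inord q).

Definition Zm1 : Z := Zneg xH.
Definition Zp1 : Z := Zpos xH.

(* Found by a computer search; no vector has an (0,3) entry. *)
Definition vlist : seq (seq (Z * (nat * nat))) :=
  [:: [:: (Zp1, (2, 1))]; [:: (Zp1, (0, 2))]; [:: (Zp1, (1, 1)); (Zm1, (0, 1))];
      [:: (Zp1, (1, 0))]; [:: (Zp1, (3, 2)); (Zp1, (2, 0))];
      [:: (Zp1, (3, 1)); (Zm1, (3, 0))]; [:: (Zp1, (0, 0))]; [:: (Zp1, (1, 3))];
      [:: (Zp1, (1, 2)); (Zp1, (2, 3))] ]%N.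

Definition vbas (i : nat) : 'M[CC]_4 :=
  \sum_(t <- nth [::] vlist i) zC t.1 *: Emx t.2.1 t.2.2.

(** Expands [v, E_rs] at e_S through [E_pq, E_rs] = delta_qr E_ps - delta_sp E_rq. *)
Definition cterm (vs : seq (Z * (nat * nat))) (S : bitseq) (r s : nat) : svec :=
  foldr (fun t acc => comb Zp1 Zp1
    (comb t.1 (Z.opp t.1) (if t.2.2 == r then [:: (keyof S t.2.1 s, Zp1)] else [::])
                          (if s == t.2.1 then [:: (keyof S r t.2.2, Zp1)] else [::])) acc)
    [::] vs.

Definition zsgn (i : nat) (S : bitseq) : Z := if odd (count id (take i S)) then Zm1 else Zp1.

Definition crow (x : bitseq * (nat * nat)) : svec :=
  foldr (fun i acc => if nth false x.1 i then acc else
    comb (zsgn i x.1) Zp1 (cterm (nth [::] vlist i) (ins i x.1) x.2.1 x.2.2) acc)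
    [::] (iota 0 9).

(** E_33 is left out: modulo the identity, which is central, it is a combination of the other
    diagonal units and adds nothing to the row space. *)
Definition units15 : seq (nat * nat) := take 15 [seq (a, b) | a <- iota 0 4, b <- iota 0 4].

Definition frows : seq (bitseq * (nat * nat)) :=
  [seq (s, y) | s <- masks4, y <- units15].

(** Sparse rows come first to limit fill-in. Five indices lie outside S and each contributes at most
    four entries, so every length is below 30. *)
Definition crows : seq svec :=
  let l := [seq crow x | x <- frows] in
  flatten [seq [seq r <- l | size r == n] | n <- iota 0 30].

Definition pivots : seq svec :=
  sort (fun p q => Pos.leb (shead p) (shead q)) (eliminate (PositiveMap.empty _) [::] crows).

Definition pivots_ok (ps : seq svec) : bool :=
  [&& (1820 < size ps)%N, all lead_ok ps & sorted (fun p q => Pos.ltb (shead p) (shead q)) ps].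

(** The elimination runs here by evaluation. Only the number of pivots, their leading terms and the
    order of their keys are inspected; what remains to be proved about the algorithm is that it
    stays in the row space. *)
Lemma pivots_okP : pivots_ok pivots.
Proof. by vm_compute. Qed.

Section Flattening.
Variables (N : nat) (key : 'I_N -> positive).

(** The coordinates of e_S (x) X. *)
Definition umat (X : 'M[CC]_4) (S : bitseq) : 'rV[CC]_N :=
  \sum_(a < 4) \sum_(b < 4) X a b *: ekey key (keyof S a b).

Lemma umatD X Y S : umat (X + Y) S = umat X S + umat Y S.
Proof.
rewrite /umat -big_split; apply: eq_bigr => a _; rewrite -big_split.
by apply: eq_bigr => b _; rewrite mxE scalerDl.
Qed.

Lemma umatZ c X S : umat (c *: X) S = c *: umat X S.
Proof.
rewrite /umat scaler_sumr; apply: eq_bigr => a _; rewrite scaler_sumr.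
by apply: eq_bigr => b _; rewrite mxE scalerA.
Qed.

Lemma umatN X S : umat (- X) S = - umat X S.
Proof. by rewrite -scaleN1r umatZ scaleN1r. Qed.

Lemma umat0 S : umat 0 S = 0.
Proof. by rewrite -(scale0r 0) umatZ scale0r. Qed.

Lemma umat_sum (I : Type) (r : seq I) (P : pred I) (X : I -> 'M[CC]_4) S :
  umat (\sum_(i <- r | P i) X i) S = \sum_(i <- r | P i) umat (X i) S.
Proof. by apply: (big_morph (umat^~ S)) => [X1 X2|]; rewrite ?umatD ?umat0. Qed.

Lemma umatE p q S : (p < 4)%N -> (q < 4)%N -> umat (Emx p q) S = ekey key (keyof S p q).
Proof.
move=> p4 q4; rewrite /umat (bigD1 (inord p)) //= [X in _ + X]big1 => [|a ap].
  rewrite addr0 (bigD1 (inord q)) //= [X in _ + X]big1 => [|b bq].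
    by rewrite addr0 mxE !eqxx scale1r !inordK.
  by rewrite mxE (negPf bq) andbF scale0r.
by rewrite big1 // => b _; rewrite mxE (negPf ap) scale0r.
Qed.

Definition frow (B : 'M[CC]_4 -> 'M[CC]_4 -> 'M[CC]_4) (v : 'I_9 -> 'M[CC]_4)
    (S : bitseq) (y : 'M[CC]_4) : 'rV[CC]_N :=
  \sum_(i < 9) if nth false S i then 0 else msgn CC i S *: umat (B (v i) y) (ins i S).

Definition flat B v : 'M[CC]_(size frows, N) :=
  \matrix_(k < size frows) let x := nth ([::], (0, 0)%N) frows k in
    frow B v x.1 (Emx x.2.1 x.2.2).

Lemma lie_bracketDl (n : nat) (x x' y : 'M[CC]_n) :
  lie_bracket (x + x') y = lie_bracket x y + lie_bracket x' y.
Proof. by rewrite /lie_bracket mulmxDl mulmxDr opprD addrACA. Qed.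

Lemma lie_bracketZl (n : nat) a (x y : 'M[CC]_n) :
  lie_bracket (a *: x) y = a *: lie_bracket x y.
Proof. by rewrite /lie_bracket -scalemxAl -scalemxAr -scalerBr. Qed.

Lemma lie_Emx p q r s : (p < 4)%N -> (q < 4)%N -> (r < 4)%N -> (s < 4)%N ->
  lie_bracket (Emx p q) (Emx r s) =
  (if q == r then Emx p s else 0) - (if s == p then Emx r q else 0).
Proof.
move=> p4 q4 r4 s4; rewrite /lie_bracket /Emx.
have H (a b c d : 'I_4) : delta_mx a b *m delta_mx c d = (if b == c then delta_mx a d else 0) :> 'M[CC]_4.
  by rewrite mul_delta_mx_cond; case: (b == c).
by rewrite !H -!val_eqE /= !inordK.
Qed.

Lemma vec1 k : vec key [:: (k, Zp1)] = ekey key k.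
Proof. by rewrite vec_cons vec_nil addr0 zC1 scale1r. Qed.

Lemma vec_cterm i S r s : (i < 9)%N -> (r < 4)%N -> (s < 4)%N ->
  vec key (cterm (nth [::] vlist i) S r s) = umat (lie_bracket (vbas i) (Emx r s)) S.
Proof.
move=> i9 r4 s4; rewrite /vbas.
have : all (fun t => (t.2.1 < 4)%N && (t.2.2 < 4)%N) (nth [::] vlist i).
  have /all_nthP h : all (all (fun t => (t.2.1 < 4)%N && (t.2.2 < 4)%N)) vlist by [].
  exact: h.
elim: (nth [::] vlist i) => [|[c [p q]] vs IH] /=.
  by move=> _; rewrite big_nil vec_nil /lie_bracket mul0mx mulmx0 subr0 umat0.
move=> /andP[/andP[p4 q4] /IH {}IH].
rewrite big_cons lie_bracketDl umatD.
rewrite vec_comb IH zC1 !scale1r; congr (_ + _).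
rewrite lie_bracketZl umatZ lie_Emx //.
rewrite vec_comb zCN scaleNr -scalerBr umatD umatN.
by congr (_ *: (_ - _)); case: ifP => _; rewrite ?vec1 ?vec_nil ?umatE ?umat0.
Qed.

Lemma zsgnE i S : zC (zsgn i S) = msgn CC i S.
Proof.
rewrite /zsgn /msgn -signr_odd; case: odd => /=; rewrite ?expr1 ?expr0 ?zC1 //.
by rewrite (zCN (Zpos xH)) zC1.
Qed.

Lemma vec_crow S r s : (r < 4)%N -> (s < 4)%N ->
  vec key (crow (S, (r, s))) = frow (@lie_bracket 4) (fun i => vbas i) S (Emx r s).
Proof.
move=> r4 s4; rewrite /frow -(big_mkord xpredT (fun i => if nth false S i then 0 else
  msgn CC i S *: umat (lie_bracket (vbas i) (Emx r s)) (ins i S))) /index_iota subn0 /crow.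
have : all (fun i => (i < 9)%N) (iota 0 9) by [].
elim: (iota 0 9) => [|i l IH] /=; first by rewrite big_nil vec_nil.
move=> /andP[i9 /IH {}IH]; rewrite big_cons.
case: ifP => hi; first by rewrite add0r.
by rewrite vec_comb IH zsgnE zC1 scale1r vec_cterm.
Qed.

Lemma mem_crows v : v \in crows -> exists2 x, x \in frows & v = crow x.
Proof.
by case/flattenP => l /mapP[n _ ->]; rewrite mem_filter => /andP[_ /mapP[x hx ->]]; exists x.
Qed.

Lemma frows_P x : x \in frows -> [/\ x.1 \in masks4, (x.2.1 < 4)%N & (x.2.2 < 4)%N].
Proof.
case/allpairsP=> -[S y] /= [hS /mem_take hy ->] /=; split => //.
  by case/allpairsP: hy => -[a b] [ha hb ->] /=; move: ha; rewrite mem_iota.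
by case/allpairsP: hy => -[a b] [ha hb ->] /=; move: hb; rewrite mem_iota.
Qed.

Lemma in_span_pivots v : v \in pivots ->
  in_span key (flat (@lie_bracket 4) (fun i => vbas i)) v.
Proof.
rewrite mem_sort; apply: in_span_eliminate => [k p||{}v /mem_crows[x hx ->]] //.
  by rewrite PositiveMap.gempty.
have [hS r4 s4] := frows_P hx.
have hi : (index x frows < size frows)%N by rewrite index_mem.
rewrite /in_span; have := row_sub (Ordinal hi) (flat (@lie_bracket 4) (fun i => vbas i)).
by rewrite rowK /= nth_index //; case: x hx hS r4 s4 hi => S [r s] /= *; rewrite vec_crow.
Qed.

(* A term a (x) b (x) c contributes a Koszul map of rank at most 70. *)
Lemma rank_flat (n : nat) (B : 'M[CC]_4 -> 'M[CC]_4 -> 'M[CC]_4) (v : 'I_9 -> 'M[CC]_4)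
    (al : 'I_n -> 'I_9 -> CC) (be : 'I_n -> 'M[CC]_4 -> CC) (c : 'I_n -> 'M[CC]_4) :
  (forall i y, B (v i) y = \sum_(t < n) (al t i * be t y) *: c t) ->
  (\rank (flat B v) <= n * 70)%N.
Proof.
move=> hB.
have [W hW] := fin_all_exists (fun t => krow_span70 (al t) (umat (c t))).
have : (flat B v <= \sum_(t < n) <<W t>>)%MS.
  apply/row_subP => k; rewrite rowK /=; set x := nth _ _ _.
  have [hS _ _] : [/\ x.1 \in masks4, (x.2.1 < 4)%N & (x.2.2 < 4)%N].
    by apply: frows_P; apply: mem_nth.
  (* Here y enters the t-th part only through the scalar be_t(y), so the 70 rows of [W t] serve all
     y at once. *)
  have -> : frow B v x.1 (Emx x.2.1 x.2.2) =
     \sum_(t < n) be t (Emx x.2.1 x.2.2) *: krow (al t) (umat (c t)) x.1.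
    under eq_bigr do rewrite /krow scaler_sumr; rewrite exchange_big /=.
    apply: eq_bigr => i _; case: ifP => hi; first by rewrite big1 // => t _; rewrite scaler0.
    rewrite hB umat_sum scaler_sumr; apply: eq_bigr => t _.
    by rewrite umatZ !scalerA; congr (_ *: _); ring.
  apply: summx_sub_sums => t _; rewrite genmxE; apply: scalemx_sub.
  exact: hW.
move/mxrankS/leq_trans; apply; apply: (leq_trans (mxrank_sum_leqif _).1) => /=.
apply: (@leq_trans (\sum_(t < n) 70)%N); last by rewrite sum_nat_const card_ord.
by apply: leq_sum => t _; rewrite mxrank_gen rank_leq_row.
Qed.

End Flattening.

Lemma rank_flat_lie_gt :
  exists (N : nat) (key : 'I_N -> positive),
    (1820 < \rank (flat key (@lie_bracket 4) (fun i => vbas i)))%N.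
Proof.
have /and3P[hs hl hsort] := pivots_okP.
exists (size pivots), (@pkey pivots); apply: leq_trans hs _.
exact: (rank_triangular hl hsort (@in_span_pivots _ _)).
Qed.

(** * Limits *)

Local Notation R := Rdefinitions.R.

Lemma cvg_cst (c : CC) : cvg_seqC (fun=> c) c.
Proof. by move=> e e0; exists 0%N => k _; rewrite subrr normr0. Qed.

Lemma eq_cvg (u v : nat -> CC) l : u =1 v -> cvg_seqC u l -> cvg_seqC v l.
Proof. by move=> uv hu e /hu[N hN]; exists N => k /hN; rewrite uv. Qed.

Lemma cvgD (u v : nat -> CC) l m : cvg_seqC u l -> cvg_seqC v m ->
  cvg_seqC (fun k => u k + v k) (l + m).
Proof.
move=> hu hv e e0; have e2 : 0 < e / 2%:R by rewrite divr_gt0 ?ltr0n.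
have [N1 h1] := hu _ e2; have [N2 h2] := hv _ e2.
exists (maxn N1 N2) => k; rewrite geq_max => /andP[/h1 k1 /h2 k2].
rewrite opprD addrACA (le_lt_trans (ler_normD _ _)) //.
by rewrite [e]splitr ltrD.
Qed.

Lemma cvgMl (c : CC) (v : nat -> CC) m : cvg_seqC v m -> cvg_seqC (fun k => c * v k) (c * m).
Proof.
move=> hv e e0; have c1 : 0 < `|c| + 1 by rewrite ltr_wpDl.
have e2 : 0 < e / (`|c| + 1) by rewrite divr_gt0.
have [N hN] := hv _ e2; exists N => k /hN hk.
rewrite -mulrBr normrM; apply: (@le_lt_trans _ _ ((`|c| + 1) * `|v k - m|)).
  by rewrite ler_wpM2r // lerDl ler01.
by rewrite mulrC -ltr_pdivlMr.
Qed.

(** Write uv = (u - l)(v - m) + l v + m (u - l); the first product is small and the rest is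
    linear. *)
Lemma cvgM (u v : nat -> CC) l m : cvg_seqC u l -> cvg_seqC v m ->
  cvg_seqC (fun k => u k * v k) (l * m).
Proof.
move=> hu hv.
have h0 : cvg_seqC (fun k => (u k - l) * (v k - m)) 0.
  move=> e e0; have [N1 h1] := hu _ e0; have [N2 h2] := hv 1 ltr01.
  exists (maxn N1 N2) => k; rewrite geq_max => /andP[/h1 k1 /h2 k2].
  rewrite subr0 normrM -[e]mulr1; apply: ltr_pM => //.
apply: (@eq_cvg (fun k => (u k - l) * (v k - m) + (l * v k + m * (u k + - l)))).
  by move=> k; ring.
have -> : l * m = 0 + (l * m + m * (l + - l)) by ring.
do 2!apply: cvgD => //; apply: cvgMl => //.
by apply: cvgD => //; apply: cvg_cst.
Qed.

Lemma cvg_sum (I : Type) (r : seq I) (P : pred I) (u : nat -> I -> CC) (l : I -> CC) :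
  (forall i, P i -> cvg_seqC (u^~ i) (l i)) ->
  cvg_seqC (fun k => \sum_(i <- r | P i) u k i) (\sum_(i <- r | P i) l i).
Proof.
move=> h; elim: r => [|i r IH].
  by rewrite big_nil; apply: eq_cvg (cvg_cst 0) => k; rewrite big_nil.
rewrite big_cons; case: ifP => Pi.
  by apply: eq_cvg (cvgD (h i Pi) IH) => k; rewrite big_cons Pi.
by apply: eq_cvg IH => k; rewrite big_cons Pi.
Qed.

Lemma cvg_prod (I : Type) (r : seq I) (u : nat -> I -> CC) (l : I -> CC) :
  (forall i, cvg_seqC (u^~ i) (l i)) ->
  cvg_seqC (fun k => \prod_(i <- r) u k i) (\prod_(i <- r) l i).
Proof.
move=> h; elim: r => [|i r IH].
  by rewrite big_nil; apply: eq_cvg (cvg_cst 1) => k; rewrite big_nil.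
by rewrite big_cons; apply: eq_cvg (cvgM (h i) IH) => k; rewrite big_cons.
Qed.

Lemma cvg_norm (u : nat -> CC) l : cvg_seqC u l -> cvg_seqC (fun k => `|u k|) `|l|.
Proof.
move=> hu e /hu[N hN]; exists N => k /hN; apply: le_lt_trans; exact: ler_dist_dist.
Qed.

(** Subsequences are encoded by the condition n <= f n, which sends tails into tails and is stable
    under composition. *)
Lemma cvg_subseq (f : nat -> nat) (u : nat -> CC) l : (forall n, n <= f n)%N ->
  cvg_seqC u l -> cvg_seqC (u \o f) l.
Proof. by move=> hf hu e /hu[N hN]; exists N => k Nk; apply: hN; apply: leq_trans (hf k). Qed.

Definition cvg_mx (m n : nat) (Ms : nat -> 'M[CC]_(m, n)) (M : 'M[CC]_(m, n)) : Prop :=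
  forall i j, cvg_seqC (fun k => Ms k i j) (M i j).

Lemma cvg_mulmx (m n p : nat) As (A : 'M[CC]_(m, n)) Bs (B : 'M[CC]_(n, p)) :
  cvg_mx As A -> cvg_mx Bs B -> cvg_mx (fun k => As k *m Bs k) (A *m B).
Proof.
move=> hA hB i j; rewrite mxE; apply: (@eq_cvg (fun k => \sum_l As k i l * Bs k l j)).
  by move=> k; rewrite mxE.
by apply: cvg_sum => l _; apply: cvgM.
Qed.

Lemma cvg_det (n : nat) As (A : 'M[CC]_n) : cvg_mx As A -> cvg_seqC (fun k => \det (As k)) (\det A).
Proof.
move=> hA; apply: cvg_sum => s _; apply: cvgMl; apply: cvg_prod => i; exact: hA.
Qed.

(** Choose A and B with A M B the identity of size rank M. Then det(A M_k B) tends to 1, so it is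
    nonzero for some k, and that M_k has rank at least rank M. *)
Lemma mxrank_lim (m n r : nat) Ms (M : 'M[CC]_(m, n)) :
  cvg_mx Ms M -> (forall k, \rank (Ms k) <= r)%N -> (\rank M <= r)%N.
Proof.
move=> hM hr.
have [B hB] : exists B, row_base M *m B = 1%:M by apply/row_freeP/row_base_free.
have [A hA] : exists A, A *m col_base M = 1%:M by apply/row_fullP/col_base_full.
have AMB : A *m M *m B = 1%:M by rewrite -[X in A *m X](mulmx_base M) mulmxA hA mul1mx.
have c1 : cvg_seqC (fun k => \det (A *m Ms k *m B)) 1.
  rewrite -(det1 CC (\rank M)) -AMB; apply: cvg_det; do 2?apply: cvg_mulmx => //;
  by move=> i j; apply: cvg_cst.
have [N hN] := c1 1 ltr01; have := hN N (leqnn N).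
have [d0|d0] := eqVneq (\det (A *m Ms N *m B)) 0.
  by rewrite d0 sub0r normrN normr1 ltxx.
move=> _; have uD : A *m Ms N *m B \in unitmx by rewrite unitmxE unitfE.
rewrite -(mxrank_unit uD); apply: leq_trans (hr N).
by apply: leq_trans (mxrankM_maxl _ _) (mxrankM_maxr _ _).
Qed.

(** * Bolzano-Weierstrass for complex matrices *)

Lemma cvg_real (u : nat -> R) (l : R) :
  (forall n : nat, `|u n - l| <= n.+1%:R^-1) -> cvg_seqC (fun n => (u n)%:C%C) l%:C%C.
Proof.
(* In the partial order on complex numbers, 0 < e forces e to be real. *)
move=> h e; rewrite ltcE /= => /andP[/eqP i0 r0].
have er : e = (complex.Re e)%:C%C by case: e i0 {r0} => a b /= ->.
exists (Num.bound (complex.Re e)^-1) => k hk.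
rewrite er -rmorphB /= normc_def /= expr0n /= addr0 sqrtr_sqr ltcR.
apply: le_lt_trans (h k) _; rewrite invf_plt ?posrE ?ltr0n //.
apply: (@lt_le_trans _ _ (Num.bound (complex.Re e)^-1)%:R).
  by apply: archi_boundP; rewrite invr_ge0 ltW.
by rewrite ler_nat (leq_trans hk).
Qed.

Lemma real_BW (u : nat -> R) : (forall n, `|u n| <= 1) ->
  exists (f : nat -> nat) (l : R), (forall n, n <= f n)%N /\
    cvg_seqC (fun n => (u (f n))%:C%C) l%:C%C.
Proof.
move=> hu.
have hc n : Rdefinitions.Rle (-1) (u n) /\ Rdefinitions.Rle (u n) 1.
  by have := hu n; rewrite ler_norml => /andP[h1 h2]; split; apply/RleP.
have [l hl] := Bolzano_Weierstrass u _ (compact_P3 (-1) 1) hc.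
have /choice[f hf] : forall n : nat, exists p : nat, (n <= p)%N /\ `|u p - l| < n.+1%:R^-1.
  move=> n; have d0 : Rdefinitions.Rlt 0 (n.+1%:R^-1 : R) by apply/RltP; rewrite invr_gt0 ltr0n.
  have [|p [np hp]] := hl (disc l (RIneq.mkposreal _ d0)) n; first by exists (RIneq.mkposreal _ d0).
  by exists p; split; [apply/ssrnat.leP | move/RltP: hp].
exists f, l; split=> [n|]; first by case: (hf n).
by apply: cvg_real => n; apply: ltW; case: (hf n).
Qed.

Lemma real_BW_family (n : nat) (u : 'I_n -> nat -> R) : (forall i k, `|u i k| <= 1) ->
  exists (f : nat -> nat) (l : 'I_n -> R), (forall k, k <= f k)%N /\
    forall i, cvg_seqC (fun k => (u i (f k))%:C%C) (l i)%:C%C.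
Proof.
elim: n u => [|n IH] u hu.
  by exists id, (fun=> 0); split => // -[].
have [f [l [hf hl]]] := IH (fun i => u (lift ord0 i)) (fun i => hu _).
have [g [m [hg hm]]] := real_BW (fun k => hu ord0 (f k)).
exists (f \o g), (fun i => if unlift ord0 i is Some j then l j else m); split.
  by move=> k /=; apply: leq_trans (hg k) (hf _).
move=> i; case: unliftP => [j|] -> //.
exact: cvg_subseq hg (hl j).
Qed.

(** Real and imaginary parts of all entries form one finite family of bounded real sequences, to
    which successive extraction applies. *)
Lemma matrix_BW (m n : nat) (As : nat -> 'M[CC]_(m, n)) : (forall k i j, `|As k i j| <= 1) ->
  exists (f : nat -> nat) (A : 'M[CC]_(m, n)), (forall k, k <= f k)%N /\ cvg_mx (As \o f) A.
Proof.
move=> hA.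
have hn (z : CC) : `|z| <= 1 -> `|complex.Re z| <= 1 /\ `|complex.Im z| <= 1.
  case: z => a b; rewrite normc_def /= (_ : 1 = 1%:C%C) // lecR => h.
  have H : a ^+ 2 + b ^+ 2 <= 1.
    rewrite -(sqr_sqrtr (addr_ge0 (sqr_ge0 a) (sqr_ge0 b))) expr2.
    by apply: mulr_ile1; rewrite ?sqrtr_ge0.
  split; rewrite -(@ler_pXn2r _ 2) ?nnegrE // expr1n real_normK ?num_real //; apply: le_trans H.
    by rewrite lerDl sqr_ge0.
  by rewrite lerDr sqr_ge0.
pose T : finType := ('I_m * 'I_n * bool)%type.
pose u (x : 'I_#|T|) k : R := let: (i, j, b) := (enum_val x : T) in
  if b then complex.Re (As k i j) else complex.Im (As k i j).
have [|f [l [hf hl]]] := @real_BW_family #|T| u.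
  by move=> x k; rewrite /u; case: (enum_val x : T) => -[i j] [];
    have [h1 h2] := hn _ (hA k i j).
pose L i j b := l (enum_rank ((i, j, b) : T)).
exists f, (\matrix_(i, j) ((L i j true)%:C%C + 'i%C * (L i j false)%:C%C)); split => // i j.
rewrite mxE; apply: (@eq_cvg (fun k => (u (enum_rank ((i, j, true) : T)) (f k))%:C%C +
   'i%C * (u (enum_rank ((i, j, false) : T)) (f k))%:C%C)).
  by move=> k; rewrite /u !enum_rankK /= [RHS]complexE.
by apply: cvgD; [apply: hl | apply: cvgMl; apply: hl].
Qed.

Local Notation bilin := ('M[CC]_4 -> 'M[CC]_4 -> 'M[CC]_4).

Lemma cvg_cst_eq (c l : CC) : cvg_seqC (fun=> c) l -> l = c.
Proof.
move=> h; apply/eqP; rewrite eq_sym -subr_eq0; apply/negP => /negP.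
rewrite -normr_gt0 => /h[N /(_ N (leqnn N))]; by rewrite ltxx.
Qed.

Lemma cvg_mx_cst (m n : nat) (M : 'M[CC]_(m, n)) : cvg_mx (fun=> M) M.
Proof. by move=> i j; apply: cvg_cst. Qed.

Lemma cvg_mxD (m n : nat) As (A : 'M[CC]_(m, n)) Bs B :
  cvg_mx As A -> cvg_mx Bs B -> cvg_mx (fun k => As k + Bs k) (A + B).
Proof.
move=> hA hB i j; rewrite mxE; apply: eq_cvg (cvgD (hA i j) (hB i j)) => k.
by rewrite mxE.
Qed.

Lemma cvg_mxZ (m n : nat) cs c As (A : 'M[CC]_(m, n)) :
  cvg_seqC cs c -> cvg_mx As A -> cvg_mx (fun k => cs k *: As k) (c *: A).
Proof.
move=> hc hA i j; rewrite mxE; apply: eq_cvg (cvgM hc (hA i j)) => k.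
by rewrite mxE.
Qed.

Lemma cvg_mx_sum (I : Type) (r : seq I) (P : pred I) (m n : nat)
    (us : nat -> I -> 'M[CC]_(m, n)) (u : I -> 'M[CC]_(m, n)) :
  (forall i, cvg_mx (us^~ i) (u i)) ->
  cvg_mx (fun k => \sum_(i <- r | P i) us k i) (\sum_(i <- r | P i) u i).
Proof.
move=> h a b; rewrite summxE; apply: (@eq_cvg (fun k => \sum_(i <- r | P i) us k i a b)).
  by move=> k; rewrite summxE.
by apply: cvg_sum => i _; apply: h.
Qed.

Lemma cvg_trace (n : nat) As (A : 'M[CC]_n) : cvg_mx As A -> cvg_seqC (fun k => \tr (As k)) (\tr A).
Proof. by move=> h; apply: cvg_sum => i _; apply: h. Qed.

Lemma cvg_flat (N : nat) (key : 'I_N -> positive) (Bs : nat -> bilin) (B : bilin)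
    (vs : nat -> 'I_9 -> 'M[CC]_4) (v : 'I_9 -> 'M[CC]_4) :
  (forall i y, cvg_mx (fun k => Bs k (vs k i) y) (B (v i) y)) ->
  cvg_mx (fun k => flat key (Bs k) (vs k)) (flat key B v).
Proof.
move=> h a b; rewrite mxE /=; set x := nth _ _ _.
apply: (@eq_cvg (fun k => frow key (Bs k) (vs k) x.1 (Emx x.2.1 x.2.2) 0 b)).
  by move=> k; rewrite mxE.
move: 0 b; apply: cvg_mx_sum => i; case: ifP => _; first exact: cvg_mx_cst.
apply: cvg_mxZ; first exact: cvg_cst.
apply: cvg_mx_sum => p; apply: cvg_mx_sum => q; apply: cvg_mxZ; last exact: cvg_mx_cst.
exact: h.
Qed.

(** * Border substitution *)

(** The projection of gl_4 to sl_4 along the scalars. Precomposing with it extends tensors, whose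
    values off sl_4 are arbitrary, to bilinear maps on all matrices; the bracket is unchanged since
    scalars are central. *)
Definition slproj (x : 'M[CC]_4) : 'M[CC]_4 := x - (\tr x / 4%:R)%:M.

Lemma slproj_sl x : slproj x \in @sl 4.
Proof.
rewrite unfold_in /sl /slproj raddfB /= mxtrace_scalar -[X in _ - X]mulr_natr divfK ?subrr //.
by rewrite pnatr_eq0.
Qed.

Lemma slprojD x y : slproj (x + y) = slproj x + slproj y.
Proof. by rewrite /slproj mxtraceD mulrDl raddfD /= opprD addrACA. Qed.

Lemma slprojZ a x : slproj (a *: x) = a *: slproj x.
Proof. by rewrite /slproj mxtraceZ -mulrA -scale_scalar_mx scalerBr. Qed.

Lemma lie_slproj x y : lie_bracket (slproj x) (slproj y) = lie_bracket x y.
Proof.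
rewrite /lie_bracket /slproj !mulmxBl !mulmxBr !mul_scalar_mx !mul_mx_scalar.
rewrite scale_scalar_mx mulrC -scale_scalar_mx.
set X := x *m y; set Y := y *m x; set a := _ *: x; set b := _ *: y; set s := _ *: _%:M.
by rewrite !opprB; apply/matrixP => i j; rewrite !mxE; ring.
Qed.

(** The trace form represents the functional; tr a is its value at the projection of the identity,
    which is 0. *)
Lemma functional_trace f : lin_functional_on f ->
  exists2 a : 'M[CC]_4, \tr a = 0 & forall x, f (slproj x) = \tr (a *m x).
Proof.
move=> hf; have sl0 : (0 : 'M[CC]_4) \in @sl 4 by rewrite unfold_in /sl mxtrace0.
have f0 : f 0 = 0.
  have /eqP := hf 1 0 0 sl0 sl0; rewrite scale1r addr0 mul1r -subr_eq subrr.
  by move/eqP.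
pose g x := f (slproj x).
have gD : {morph g : x y / x + y}.
  by move=> x y; rewrite /g slprojD -[X in f (X + _)]scale1r hf ?slproj_sl // mul1r.
have gZ c x : g (c *: x) = c * g x.
  by rewrite /g slprojZ -[X in f X]addr0 hf ?slproj_sl // f0 addr0.
have g0 : g 0 = 0 by rewrite -(scale0r 0) gZ mul0r.
pose a : 'M[CC]_4 := \matrix_(i, j) g (delta_mx j i).
have ga x : g x = \tr (a *m x).
  rewrite {1}[x]matrix_sum_delta (big_morph g gD g0) /mxtrace.
  under eq_bigr do rewrite (big_morph g gD g0).
  rewrite exchange_big /=; apply: eq_bigr => i _; rewrite mxE; apply: eq_bigr => j _.
  by rewrite gZ mxE mulrC.
exists a => //; rewrite -[a]mulmx1 -ga /g /slproj mxtrace1 divff ?pnatr_eq0 //.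
by rewrite subrr.
Qed.

(** A decomposition into n rank one terms, with functionals written through the trace form. The
    condition tr(a_t) = 0 will later exclude scalar matrices as limit hyperplanes. *)
Definition trdec (n : nat) (B : bilin) : Prop :=
  exists a b c : 'I_n -> 'M[CC]_4, (forall t, \tr (a t) = 0) /\
    forall x y, B x y = \sum_(t < n) (\tr (a t *m x) * \tr (b t *m y)) *: c t.

Lemma trdecW m n B : (m <= n)%N -> trdec m B -> trdec n B.
Proof.
move=> /subnK <-; elim: (n - m)%N => // p IH /IH [a [b [c [ha h]]]].
pose ext (u : 'I_(p + m) -> 'M[CC]_4) (i : 'I_(p + m).+1) := if unlift ord0 i is Some j then u j else 0.
exists (ext a), (ext b), (ext c); split => [t|x y].
  by rewrite /ext; case: unlift => *; rewrite ?mxtrace0.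
rewrite big_ord_recl /ext unlift_none scaler0 add0r h.
by apply: eq_bigr => t _; rewrite liftK.
Qed.

Lemma border_trdec r : border_rank_le (@lie_bracket 4) r ->
  exists2 Bs : nat -> bilin, (forall k, trdec r (Bs k)) &
    forall x y, cvg_mx (fun k => Bs k x y) (lie_bracket x y).
Proof.
move=> [Bs [hr hB]]; exists (fun k x y => Bs k (slproj x) (slproj y)) => [k|x y]; last first.
  by rewrite -lie_slproj => i j; apply: hB; apply: slproj_sl.
have [al [be [c [hal [hbe [_ h]]]]]] := hr k.
have /choice[a ha] : forall t, exists a : 'M[CC]_4, \tr a = 0 /\ forall x, al t (slproj x) = \tr (a *m x).
  by move=> t; have [a] := functional_trace (hal t); exists a.
have /choice[b hb] : forall t, exists b : 'M[CC]_4, forall x, be t (slproj x) = \tr (b *m x).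
  by move=> t; have [b] := functional_trace (hbe t); exists b.
exists a, b, c; split=> [t|x y]; first by case: (ha t).
rewrite h ?slproj_sl //; apply: eq_bigr => t _.
by have [_ ->] := ha t; rewrite hb.
Qed.

(** Linearity in the first factor is recorded because the vectors inserted later move with k, while
    convergence is known only at fixed arguments. *)
Definition hyp_rank26 (B : bilin) (A : 'M[CC]_4) : Prop :=
  (forall c x x' y, B (c *: x + x') y = c *: B x y + B x' y) /\
  exists (a b c : 'I_26 -> 'M[CC]_4), forall x y, \tr (A *m x) = 0 ->
    B x y = \sum_(t < 26) (\tr (a t *m x) * \tr (b t *m y)) *: c t.

Definition lim_hyp (A : 'M[CC]_4) : Prop :=
  exists (Bs : nat -> bilin) (As : nat -> 'M[CC]_4),
    [/\ forall k, hyp_rank26 (Bs k) (As k),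
        forall x y, cvg_mx (fun k => Bs k x y) (lie_bracket x y) & cvg_mx As A].

Definition norm1 (A : 'M[CC]_4) : CC := \sum_i \sum_j `|A i j|.

Lemma norm1_gt0 A : A != 0 -> 0 < norm1 A.
Proof.
move=> A0; rewrite lt_def; apply/andP; split; last by do 2!apply: sumr_ge0 => ? _.
apply: contra A0 => /eqP h; apply/eqP/matrixP => i j; rewrite mxE; apply/eqP.
have /psumr_eq0P h1 := h; have := h1 (fun i _ => sumr_ge0 _ (fun j _ => normr_ge0 (A i j))) i isT.
by move/psumr_eq0P => h2; rewrite -normr_eq0; apply/eqP; apply: h2.
Qed.

Lemma norm1_ge (A : 'M[CC]_4) i j : `|A i j| <= norm1 A.
Proof.
rewrite /norm1 (bigD1 i) //= (bigD1 j) //= -addrA lerDl addr_ge0 //.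
  by apply: sumr_ge0.
by do 2!apply: sumr_ge0 => ? _.
Qed.

Lemma norm1Z c A : norm1 (c *: A) = `|c| * norm1 A.
Proof.
rewrite /norm1 mulr_sumr; apply: eq_bigr => i _; rewrite mulr_sumr.
by apply: eq_bigr => j _; rewrite mxE normrM.
Qed.

Lemma trdec_hyp B : trdec 27 B -> exists A, [/\ norm1 A = 1, \tr A = 0 & hyp_rank26 B A].
Proof.
move=> [a [b [c [ha h]]]].
have lin k x x' y : B (k *: x + x') y = k *: B x y + B x' y.
  rewrite !h scaler_sumr -big_split; apply: eq_bigr => t _ /=.
  rewrite mulmxDr -scalemxAr mxtraceD mxtraceZ mulrDl scalerDl scalerA; congr (_ *: _ + _); ring.
have [A [A0 trA hA]] : exists A : 'M[CC]_4, [/\ A != 0, \tr A = 0 &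
    forall x, \tr (A *m x) = 0 -> \tr (a ord0 *m x) = 0].
  have [a0|a0] := eqVneq (a ord0) 0; last by exists (a ord0).
  (* If the first functional vanishes, any nonzero traceless matrix defines a suitable
     hyperplane. *)
  exists (delta_mx 0 1); split => [||x _].
  - by apply/eqP => /matrixP/(_ 0 1); rewrite !mxE /= => /eqP; rewrite oner_eq0.
  - by rewrite /mxtrace big1 // => i _; rewrite mxE; case: eqP => //= ->.
  - by rewrite a0 mul0mx mxtrace0.
have n0 := norm1_gt0 A0.
exists ((norm1 A)^-1 *: A); split.
- by rewrite norm1Z normfV gtr0_norm // mulVf // gt_eqF.
- by rewrite mxtraceZ trA mulr0.
split => //; exists (a \o lift ord0), (b \o lift ord0), (c \o lift ord0) => x y.
rewrite -scalemxAl mxtraceZ => /eqP; rewrite mulf_eq0 invr_eq0 gt_eqF //= => /eqP/hA e.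
by rewrite h big_ord_recl e mul0r scale0r add0r.
Qed.

(** The normalisation [norm1] = 1 bounds the entries, which gives a convergent subsequence, and
    passes to the limit by continuity, which keeps A nonzero. *)
Lemma border_lim_hyp r : (r <= 27)%N -> border_rank_le (@lie_bracket 4) r ->
  exists A, [/\ A != 0, \tr A = 0 & lim_hyp A].
Proof.
move=> r27 /border_trdec[Bs hd hB].
have /choice[As hAs] := fun k => trdec_hyp (trdecW r27 (hd k)).
have [|f [A [hf hA]]] := @matrix_BW 4 4 As.
  by move=> k i j; have [<- _ _] := hAs k; apply: norm1_ge.
exists A; split.
- apply/eqP => A0; have : cvg_seqC (fun k => norm1 (As (f k))) (norm1 A).
    by apply: cvg_sum => i _; apply: cvg_sum => j _; apply: cvg_norm; apply: hA.
  have -> : norm1 A = 0 by rewrite A0 /norm1 big1 // => i _; rewrite big1 // => j _; rewrite mxE normr0.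
  move=> h; have /cvg_cst_eq/eqP : cvg_seqC (fun=> 1) 0.
    by apply: eq_cvg h => k; have [-> _ _] := hAs (f k).
  by rewrite eq_sym oner_eq0.
- apply: cvg_cst_eq; apply: eq_cvg (cvg_trace hA) => k /=.
  by have [_ -> _] := hAs (f k).
- exists (fun k => Bs (f k)), (As \o f); split => // [k|x y].
    by have [_ _] := hAs (f k).
  by move=> i j; exact: (cvg_subseq hf (hB x y i j)).
Qed.

(** Here g' is c times the inverse of g. Cyclicity of the trace carries the hyperplane of A to that
    of g A g'. The factor c^-3 appears because [g'xg, g'yg] = c g'[x,y]g, and the outer g and g'
    contribute c twice more. *)
Lemma lim_hyp_conj (c : CC) (g g' A : 'M[CC]_4) : c != 0 -> g *m g' = c%:M ->
  lim_hyp A -> lim_hyp (g *m A *m g').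
Proof.
move=> c0 gg' [Bs [As [hr hB hA]]].
have g'g : g' *m g = c%:M.
  have h1 : g *m (c^-1 *: g') = 1%:M by rewrite -scalemxAr gg' scale_scalar_mx mulVf.
  have := mulmx1C h1; rewrite -scalemxAl => h2.
  by rewrite -[LHS]scale1r -(divff c0) -scalerA h2 scale_scalar_mx mulr1.
exists (fun k x y => c^-3 *: (g *m Bs k (g' *m x *m g) (g' *m y *m g) *m g')), (fun k => g *m As k *m g').
split=> [k|x y|]; last by apply: cvg_mulmx; [apply: cvg_mulmx => //|]; apply: cvg_mx_cst.
- have [lin [a [b [d h]]]] := hr k; split=> [k' x x' y|].
    rewrite mulmxDr mulmxDl -scalemxAr -scalemxAl lin mulmxDr mulmxDl -scalemxAr -scalemxAl scalerDr !scalerA.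
    by rewrite mulrC.
  have trg (M x : 'M[CC]_4) : \tr (M *m (g' *m x *m g)) = \tr (g *m M *m g' *m x).
    by rewrite !mulmxA mxtrace_mulC !mulmxA.
  exists (fun t => g *m a t *m g'), (fun t => g *m b t *m g'), (fun t => c^-3 *: (g *m d t *m g')) => x y hx.
  rewrite h ?trg // mulmx_sumr mulmx_suml scaler_sumr; apply: eq_bigr => t _.
  by rewrite !trg -scalemxAr -scalemxAl !scalerA mulrC.
- have -> : lie_bracket x y = c^-3 *: (g *m lie_bracket (g' *m x *m g) (g' *m y *m g) *m g').
    have E u w : g' *m u *m g *m (g' *m w *m g) = c *: (g' *m (u *m w) *m g).
      by rewrite !mulmxA -(mulmxA _ g g') gg' mul_mx_scalar -!scalemxAl -?mulmxA.
    rewrite /lie_bracket !E -scalerBr -mulmxBl -mulmxBr.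
    rewrite -scalemxAr -scalemxAl !mulmxA gg' -(mulmxA _ g g') gg' mul_mx_scalar mul_scalar_mx.
    rewrite !scalerA -[LHS]scale1r; congr (_ *: _); by field.
  apply: cvg_mxZ; first exact: cvg_cst.
  by apply: cvg_mulmx; [apply: cvg_mulmx => //|]; apply: cvg_mx_cst.
Qed.

(** Moves v_i into the hyperplane tr(A x) = 0 along E_03, whose pairing with A is A_30. Multiplying
    v_i by A_30, instead of dividing by it, keeps the result polynomial in A. *)
Definition vadj (A : 'M[CC]_4) (i : 'I_9) : 'M[CC]_4 :=
  A (inord 3) (inord 0) *: vbas i + (- \tr (A *m vbas i)) *: Emx 0 3.

Lemma tr_mul_Emx (A : 'M[CC]_4) p q : \tr (A *m Emx p q) = A (inord q) (inord p).
Proof.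
rewrite mxtrace_mulC /Emx /mxtrace (bigD1 (inord p)) //= big1 ?addr0.
  rewrite mxE (bigD1 (inord q)) //= big1 ?addr0 => [|j jq]; first by rewrite mxE !eqxx mul1r.
  by rewrite mxE (negPf jq) andbF mul0r.
by move=> i ip; rewrite mxE big1 // => j _; rewrite mxE (negPf ip) mul0r.
Qed.

Lemma tr_vadj A i : \tr (A *m vadj A i) = 0.
Proof.
rewrite /vadj mulmxDr mxtraceD -!scalemxAr !mxtraceZ tr_mul_Emx; ring.
Qed.

Lemma cvg_vadj As A i : cvg_mx As A -> cvg_mx (fun k => vadj (As k) i) (vadj A i).
Proof.
move=> hA; apply: cvg_mxD; apply: cvg_mxZ; try exact: cvg_mx_cst.
  exact: hA.
apply: (@eq_cvg (fun k => (-1) * \tr (As k *m vbas i))) => [k|]; first by rewrite mulN1r.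
rewrite -[X in cvg_seqC _ X]mulN1r; apply: cvgMl; apply: cvg_trace; apply: cvg_mulmx => //; exact: cvg_mx_cst.
Qed.

Lemma rank_flat_vadj N (key : 'I_N -> positive) A : lim_hyp A ->
  (\rank (flat key (@lie_bracket 4) (vadj A)) <= 1820)%N.
Proof.
move=> [Bs [As [hr hB hA]]].
apply: (@mxrank_lim _ _ _ (fun k => flat key (Bs k) (vadj (As k)))) => [|k].
  apply: cvg_flat => i y.
  (* Linearity puts the dependence on k into scalars, leaving the fixed arguments v_i, E_03 and 0;
     the last comes from applying [lin] to a bare multiple. *)
  have E k : Bs k (vadj (As k) i) y = As k (inord 3) (inord 0) *: Bs k (vbas i) y +
      ((-1) * \tr (As k *m vbas i)) *: Bs k (Emx 0 3) y + Bs k 0 y.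
    have [lin _] := hr k.
    by rewrite /vadj lin -[_ *: Emx 0 3]addr0 lin addrA mulN1r.
  rewrite (_ : lie_bracket _ _ = A (inord 3) (inord 0) *: lie_bracket (vbas i) y +
      ((-1) * \tr (A *m vbas i)) *: lie_bracket (Emx 0 3) y + lie_bracket 0 y); last first.
    by rewrite -!lie_bracketZl -!lie_bracketDl addr0 mulN1r.
  move=> p q; apply: (@eq_cvg (fun k => (As k (inord 3) (inord 0) *: Bs k (vbas i) y +
      ((-1) * \tr (As k *m vbas i)) *: Bs k (Emx 0 3) y + Bs k 0 y) p q)) => [k|]; first by rewrite E.
  move: p q; apply: cvg_mxD => //; apply: cvg_mxD; apply: cvg_mxZ => //.
  apply: cvgMl; apply: cvg_trace; apply: cvg_mulmx => //; exact: cvg_mx_cst.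
have [lin [a [b [c h]]]] := hr k.
apply: (@rank_flat _ _ 26 _ _ (fun t i => \tr (a t *m vadj (As k) i)) (fun t y => \tr (b t *m y)) c).
by move=> i y; apply: h; apply: tr_vadj.
Qed.

(** * Degeneration of the hyperplane *)

Lemma lim_hyp_perm (s : 'S_4) A : lim_hyp A -> lim_hyp (\matrix_(i, j) A (s i) (s j)).
Proof.
move=> hA; have := @lim_hyp_conj 1 (perm_mx s) (perm_mx s^-1) A (oner_neq0 _).
rewrite -perm_mxM mulgV perm_mx1 => /(_ erefl hA).
rewrite -row_permE -col_permE [X in lim_hyp X -> _](_ : _ = \matrix_(i, j) A (s i) (s j)) //.
by apply/matrixP => i j; rewrite !mxE.
Qed.

(** The transposition of p and i settles p; a transposition fixing p, applied before it, corrects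
    q. *)
Lemma perm_two (i j p q : 'I_4) : i != j -> p != q -> exists s : 'S_4, s p = i /\ s q = j.
Proof.
move=> ij pq; pose j' := tperm p i j.
have pj : j' != p by rewrite /j' -[X in _ != X](tpermR p i) (inj_eq perm_inj) eq_sym.
exists (tperm q j' * tperm p i)%g; rewrite !permM tpermL; split; last by rewrite /j' tpermK.
have -> : tperm q j' p = p by rewrite tpermD // eq_sym.
exact: tpermL.
Qed.

Lemma lim_hyp_offdiag (A : 'M[CC]_4) i j : i != j -> A i j != 0 -> lim_hyp A ->
  exists A', lim_hyp A' /\ A' (inord 3) (inord 0) != 0.
Proof.
move=> ij Aij hA; have [|s [s3 s0]] := @perm_two i j (inord 3) (inord 0) ij.
  by rewrite -val_eqE /= !inordK.
exists (\matrix_(a, b) A (s a) (s b)); split; first exact: lim_hyp_perm.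
by rewrite mxE s3 s0.
Qed.

(** A nonzero off-diagonal entry is permuted into the corner. If A is diagonal with A_ii != A_jj,
    conjugation by 1 + E_ij creates the (i,j) entry A_jj - A_ii. A scalar A of trace zero would
    vanish. *)
Lemma lim_hyp_corner (A : 'M[CC]_4) : A != 0 -> \tr A = 0 -> lim_hyp A ->
  exists A', lim_hyp A' /\ A' (inord 3) (inord 0) != 0.
Proof.
move=> A0 trA hA.
have [/existsP[i /existsP[j /andP[ij Aij]]]|hd] :=
  boolP [exists i, exists j, (i != j) && (A i j != 0)]; first exact: (lim_hyp_offdiag ij Aij hA).
have dA i j : i != j -> A i j = 0.
  move=> ij; apply/eqP; apply: contraNT hd => Aij.
  by apply/existsP; exists i; apply/existsP; exists j; rewrite ij.
have [/existsP[i /existsP[j Aij]]|he] := boolP [exists i, exists j, A i i != A j j].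
  have ij : i != j by apply: contraNneq Aij => ->.
  have h1 : (1%:M + delta_mx i j) *m (1%:M - delta_mx i j) = 1%:M :> 'M[CC]_4.
    rewrite mulmxDl !mulmxBr mulmx1 mul1mx mulmx1 mul_delta_mx_cond eq_sym (negPf ij) subr0.
    by rewrite subrK.
  apply: (lim_hyp_offdiag ij _ (lim_hyp_conj (oner_neq0 _) h1 hA)).
  have EA (M : 'M[CC]_4) b : (delta_mx i j *m M) i b = M j b.
    rewrite mxE (bigD1 j) //= big1 ?addr0 => [|k kj]; first by rewrite mxE !eqxx mul1r.
    by rewrite mxE (negPf kj) andbF mul0r.
  have AE (M : 'M[CC]_4) : (M *m delta_mx i j) i j = M i i.
    rewrite mxE (bigD1 i) //= big1 ?addr0 => [|k ki]; first by rewrite mxE !eqxx mulr1.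
    by rewrite mxE (negPf ki) mulr0.
  have addE (M P : 'M[CC]_4) a b : (M + P) a b = M a b + P a b by rewrite mxE.
  have oppE (M : 'M[CC]_4) a b : (- M) a b = - M a b by rewrite mxE.
  rewrite mulmxBr mulmx1 mulmxDl mul1mx !(addE, oppE, AE, EA).
  have ji : j != i by rewrite eq_sym.
  by rewrite (dA i j ij) (dA j i ji) add0r addr0 subr_eq0 eq_sym.
case/eqP: A0; apply/matrixP => i j; rewrite mxE; have [<-|/dA //] := eqVneq i j.
move/eqP: trA; rewrite /mxtrace (eq_bigr (fun=> A i i)) => [|k _].
  by rewrite sumr_const card_ord -mulr_natr mulf_eq0 pnatr_eq0 orbF => /eqP.
apply/eqP; apply: contraNT he => Aij.
by apply/existsP; exists k; apply/existsP; exists i.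
Qed.

(** Conjugation scales entry (a,b) by h to the power 2 - w(a) + w(b), which is 0 only at (3,0). *)
Definition torus_weight (i : 'I_4) : nat := nth 0%N [:: 0; 1; 1; 2]%N i.

Lemma vbas_corner (i : 'I_9) : vbas i (inord 0) (inord 3) = 0.
Proof.
rewrite /vbas; have : all (fun t => [&& (t.2.1 < 4)%N, (t.2.2 < 4)%N & (t.2 != (0, 3)%N)]) (nth [::] vlist i).
  have /all_nthP h : all (all (fun t => [&& (t.2.1 < 4)%N, (t.2.2 < 4)%N & (t.2 != (0, 3)%N)])) vlist by [].
  exact: h.
move=> /allP h; rewrite summxE big_seq big1 // => -[c [p q]] /h /and3P[/= p4 q4 pq].
rewrite mxE mxE -!val_eqE /= !inordK //; move: pq; rewrite xpair_eqE.
by rewrite eq_sym [(3 == _)%N]eq_sym => /negPf ->; rewrite mulr0.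
Qed.

Lemma cvg_inv_succ : cvg_seqC (fun k => k.+1%:R^-1) 0.
Proof.
apply: (@eq_cvg (fun k => (k.+1%:R^-1 : Rdefinitions.R)%:C%C)) => [k|].
  by rewrite fmorphV rmorph_nat.
by apply: cvg_real => n; rewrite subr0 ger0_norm // invr_ge0 ler0n.
Qed.

(* Conjugation by diag(h^2, h, h, 1) with h -> 0 isolates the (3,0) entry. *)
Lemma rank_flat_torus N (key : 'I_N -> positive) (A : 'M[CC]_4) : lim_hyp A ->
  (\rank (flat key (@lie_bracket 4) (fun i => A (inord 3) (inord 0) *: vbas i)) <= 1820)%N.
Proof.
move=> hA; pose h (k : nat) : CC := k.+1%:R^-1.
have h0 k : h k != 0 by rewrite invr_eq0 pnatr_eq0.
pose g k : 'M[CC]_4 := diag_mx (\row_a h k ^+ (2 - torus_weight a)).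
pose g' k : 'M[CC]_4 := diag_mx (\row_a h k ^+ torus_weight a).
have gg' k : g k *m g' k = (h k ^+ 2)%:M.
  apply/matrixP => a b; rewrite mul_diag_mx !mxE; have [->|_] := eqVneq a b; last by rewrite mulr0.
  rewrite !mulr1n -exprD subnK //.
  by case: b => -[|[|[|[|?]]]].
pose As k := g k *m A *m g' k.
have hAs k : lim_hyp (As k) by apply: lim_hyp_conj (gg' k) hA; rewrite expf_neq0.
pose L : 'M[CC]_4 := A (inord 3) (inord 0) *: Emx 3 0.
have cL : cvg_mx As L.
  move=> a b; apply: (@eq_cvg (fun k => A a b * h k ^+ (2 - torus_weight a + torus_weight b))).
    by move=> k; rewrite /As mul_mx_diag mul_diag_mx !mxE exprD; ring.
  have ch n : cvg_seqC (fun k => h k ^+ n) (n == 0%N)%:R.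
    elim: n => [|n IH]; first by apply: cvg_cst.
    apply: (@eq_cvg (fun k => h k * h k ^+ n)) => [k|]; first by rewrite exprS.
    by have -> : (n.+1 == 0%N)%:R = 0 * (n == 0%N)%:R :> CC by [rewrite mul0r]; apply: cvgM cvg_inv_succ IH.
  have -> : L a b = A a b * (2 - torus_weight a + torus_weight b == 0)%N%:R.
    rewrite !mxE; have -> : (2 - torus_weight a + torus_weight b == 0)%N = (a == inord 3) && (b == inord 0).
      rewrite /torus_weight -!val_eqE /= !inordK //.
      by case: a => -[|[|[|[|?]]]] //= ?; case: b => -[|[|[|[|?]]]].
    by case: eqP => [->|_]; case: eqP => [->|_]; rewrite ?mulr0.
  by apply: cvgMl; apply: ch.
(* The rank bound, being a closed condition, is passed to the limit in place of [lim_hyp] itself. *)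
apply: (@mxrank_lim _ _ _ (fun k => flat key (@lie_bracket 4) (vadj (As k)))) => [|k]; last exact: rank_flat_vadj.
apply: cvg_flat => i y.
(* The correction disappears at L: tr(L v_i) is A_30 times the (0,3) entry of v_i, which is zero by
   the choice of the vectors. *)
have -> : A (inord 3) (inord 0) *: vbas i = vadj L i.
  rewrite /vadj /L -scalemxAl mxtraceZ mxtrace_mulC tr_mul_Emx vbas_corner.
  by rewrite mulr0 oppr0 scale0r addr0 !mxE !eqxx mulr1.
have cv := cvg_vadj i cL.
have E a : lie_bracket a y = a *m y + (-1) *: (y *m a) by rewrite scaleN1r.
move=> p q; apply: (@eq_cvg (fun k => (vadj (As k) i *m y + (-1) *: (y *m vadj (As k) i)) p q)).
  by move=> k; rewrite E.
rewrite E; move: p q; apply: cvg_mxD; last apply: cvg_mxZ; do ?exact: cvg_cst.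
  by apply: cvg_mulmx => //; apply: cvg_mx_cst.
by apply: cvg_mulmx => //; apply: cvg_mx_cst.
Qed.

Lemma flatZ N (key : 'I_N -> positive) c v :
  flat key (@lie_bracket 4) (fun i => c *: v i) = c *: flat key (@lie_bracket 4) v.
Proof.
apply/row_matrixP => k; rewrite linearZ /= !rowK /= /frow scaler_sumr.
apply: eq_bigr => i _; case: ifP => _; first by rewrite scaler0.
by rewrite lie_bracketZl umatZ !scalerA mulrC.
Qed.

(* border rank of T_{sl_4} >= 28 : every r with border rank <= r has r >= 28 *)
Theorem theorem3 : forall r : nat, border_rank_le (@lie_bracket 4) r -> (28 <= r)%N.
Proof.
move=> r hr; rewrite ltnNge; apply/negP => r27.
have [A [A0 trA hA]] := border_lim_hyp r27 hr.
have [A' [hA' c0]] := lim_hyp_corner A0 trA hA.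
have [N [key]] := rank_flat_lie_gt.
rewrite ltnNge => /negP; apply.
by have := rank_flat_torus key hA'; rewrite flatZ mxrank_scale_nz.
Qed.
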